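(* In the setting of the context (a weighted genus two admissible cover over the standard log point, with associated function $\lambda$ and degree one effective divisor $D$ on $\Delta_T$), if $D=\tfrac12(D_1+D_2)$ for two distinct points $D_1,D_2$ of $\Delta_T$, then $\lambda(D_1)=\lambda(D_2)=0$ (i.e. $\lambda_T(D_1)=\lambda_T(D_2)=0$, equivalently $\lambda$ vanishes on the preimages of $D_1$ and $D_2$).
   Context: *Admissible cover.* Over $\mathbb C$, let $\psi\colon(C,D_R)\to(T,D_B)$ be a hyperelliptic admissible cover: a finite degree two morphism of nodal curves, $C$ connected of arithmetic genus $2$, $T$ of genus $0$, étale on $C^{sm}\setminus D_R$, simply ramified along the six smooth points $D_R$ mapping to six distinct smooth points $D_B$, mapping nodes to nodes with the same ramification order $1$ or $2$ on both branches. It carries a weight $w\colon V(\Gamma)\to\mathbb N$ on the dual graph of $C$, not identically zero, such that with $w_T(v)=\sum_{v'\mapsto v}w(v')$ every component of $T$ with $w_T=0$ has at least three nodes or branch points. *Metric.* $\Gamma=\mathrm{trop}(C)$ and the tree $\Gamma_T=\mathrm{trop}(T)$ are the dual graphs with positive real edge lengths, where the length of an edge of $\Gamma_T$ is the ramification order (expansion factor) times the length of any edge of $\Gamma$ above it; $\mathrm{trop}(\psi)\colon\Gamma\to\Gamma_T$ is the induced harmonic map of degree two. For a subcurve, genus means arithmetic genus: first Betti number plus sum of vertex genera. *Functions.* A piecewise linear (PL) function has integral slopes on (a subdivision of) $\Gamma$ (half-integral slopes allowed on $\Gamma_T$); $\mathrm{div}(\lambda)(v)$ is the sum of outgoing slopes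 at $v$; $K_\Gamma(v)=2g(v)-2+\mathrm{val}(v)$. Pullback along $\mathrm{trop}(\psi)$ composes functions and multiplies divisors by local degrees. On $\Gamma_T$ let $D'(v)=\mathrm{val}(v)-2+\tfrac12\deg(D_B|_v)$ (valence counts edges only); it has degree $1$ and pulls back to $K_\Gamma$. For each vertex $v_0$ of $\Gamma_T$ there is a PL function $\overline\lambda_T$, unique up to constants, with $D'+\mathrm{div}(\overline\lambda_T)=v_0$; its pullback to $\Gamma$ is an *admissible function*. Let $\overline\lambda_1,\dots,\overline\lambda_s$ be all of them and let $\lambda_i$ be $\overline\lambda_i$ shifted by a constant so that vertices with $\lambda_i>0$ have weight $0$ while those with $\lambda_i\ge0$ have total weight $\ge1$ (i.e. the maximum of $\lambda_i$ on vertices of positive weight is $0$). Define $\lambda=\max\{0,\lambda_1,\dots,\lambda_s\}$, a PL function on a subdivision of $\Gamma$, pulled back from $\lambda_T$ on $\Gamma_T$. Put $\Delta^\circ=\{\lambda>0\}$ and let $\Delta$ be the minimal subcurve of genus two containing the closure of $\Delta^\circ$, $\Delta_T$ its image in $\Gamma_T$. With $D'$ computed using valences in $\Delta_T$, $D=D'+\mathrm{div}(\lambda_T)$ is an effective divisor of degree $1$ with half-integral coefficients on $\Delta_T$ (a point, or half the sum of two points in the locus of expansion factor $2$) and $\mathrm{trop}(\psi)^*D=K_\Delta+\mathrm{div}(\lambda)$ on $\Delta$. *)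

(* Defs.v *)
From HB Require Import structures.
From mathcomp Require Import all_boot all_order all_algebra.
From mathcomp Require Import all_classical all_reals.

Set Implicit Arguments.
Unset Strict Implicit.
Unset Printing Implicit Defensive.

Import Order.TTheory GRing.Theory Num.Theory.
Local Open Scope ring_scope.

Record mgraph (R : realType) := MGraph {
  vert : finType;
  edge : finType;
  esrc : edge -> vert;
  etgt : edge -> vert;
  elen : edge -> R;
  elen_gt0 : forall e, 0 < elen e;
  vgen : vert -> nat
}.

Section MetricGraph.
Variables (R : realType) (G : mgraph R).

(* [(e, true)] is the end of [e] at its source, [(e, false)] the one at its
   target; a loop has two ends at the same vertex. *)
Definition halfedge := (edge G * bool)%type.

Definition base (h : halfedge) : vert G := if h.2 then esrc h.1 else etgt h.1.

Definition adj : rel (vert G) := fun u v =>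
  [exists h : halfedge, (base h == u) && (base (h.1, ~~ h.2) == v)].

Definition mconnected : Prop :=
  (0 < #|vert G|)%N /\ forall u v : vert G, connect adj u v.

(* The truncated subtraction is exact: a graph has at most as many vertices as
   edges and components together. *)
Definition betti1 : nat :=
  (#|edge G| + n_comp adj (vert G) - #|vert G|)%N.

Definition genus : nat := (betti1 + \sum_(v : vert G) vgen v)%N.

(* A point is a vertex, or lies in the open edge [e] at distance [t] from its
   source. *)
Inductive mpoint : Type :=
| Vert of vert G
| Inner (e : edge G) of {t : R | 0 < t < elen e}.

(* The parametrisation of the closed edge [e] by arc length from its source,
   clamped outside [0, elen e]. *)
Definition on_edge (e : edge G) (t : R) : mpoint :=
  match insub t : option {t : R | 0 < t < elen e} with
  | Some u => Inner u
  | None => if t <= 0 then Vert (esrc e) else Vert (etgt e)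
  end.

Definition pgenus (p : mpoint) : nat := if p is Vert v then vgen v else 0%N.

(* The directions at [p]: at a vertex, the half-edges based there; inside an
   edge [e], both [(e, true)] and [(e, false)]. *)
Definition tangent (p : mpoint) (h : halfedge) : bool :=
  match p with
  | Vert v => base h == v
  | @Inner e _ => h.1 == e
  end.

(* The point reached from [p] after distance [t] in the direction [h]; used
   only with [tangent p h] and small [t]. *)
Definition travel (p : mpoint) (h : halfedge) (t : R) : mpoint :=
  match p with
  | Vert _ => on_edge h.1 (if h.2 then t else elen h.1 - t)
  | @Inner e s => on_edge e (if h.2 then val s + t else val s - t)
  end.

Definition has_slope (f : mpoint -> R) (p : mpoint) (h : halfedge) (s : R) :=
  exists2 eps : R, 0 < eps &
    forall t, 0 <= t <= eps -> f (travel p h t) = f p + s * t.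

(* The outgoing slope; it exists whenever [f] is piecewise linear. *)
Definition slope (f : mpoint -> R) (p : mpoint) (h : halfedge) : R :=
  xget 0 [set s | has_slope f p h s]%classic.

Definition pdiv (f : mpoint -> R) (p : mpoint) : R :=
  \sum_(h : halfedge | tangent p h) slope f p h.

Definition half_PL (f : mpoint -> R) : Prop :=
  forall e : edge G, exists (n : nat) (t : nat -> R),
    [/\ t 0%N = 0, t n = elen e,
        forall i, (i < n)%N -> t i < t i.+1 &
        forall i, (i < n)%N -> exists k : int, forall x,
          t i <= x <= t i.+1 ->
          f (on_edge e x) = f (on_edge e (t i)) + k%:~R / 2 * (x - t i)].

Definition mclosure (S : set mpoint) : set mpoint :=
  [set p | S p \/ forall eps : R, 0 < eps ->
     exists h t, [/\ tangent p h, 0 <= t < eps & S (travel p h t)]]%classic.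

Definition germ_in (S : set mpoint) (p : mpoint) (h : halfedge) : Prop :=
  exists2 eps : R, 0 < eps & forall t, 0 <= t <= eps -> S (travel p h t).

Definition valence_in (S : set mpoint) (p : mpoint) : nat :=
  #|[pred h : halfedge | tangent p h && `[< germ_in S p h >]]|.

Definition valence (v : vert G) : nat := #|[pred h : halfedge | base h == v]|.

End MetricGraph.

Arguments mpoint {R} G.
Arguments halfedge {R} G.
Arguments betti1 {R} G.
Arguments genus {R} G.
Arguments mconnected {R} G.

Section Subcurve.
Variables (R : realType) (G : mgraph R).

(* A map from [H] to [G] carrying each edge of [H] isometrically onto a segment
   of an edge of [G]. *)
Record segment_map (H : mgraph R) := SegmentMap {
  pos : vert H -> mpoint G;
  seg : edge H -> edge G;
  off : edge H -> R;
  off_ge0 : forall e, 0 <= off e;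
  off_le : forall e, off e + elen e <= elen (seg e);
  pos_src : forall e, pos (esrc e) = on_edge (seg e) (off e);
  pos_tgt : forall e, pos (etgt e) = on_edge (seg e) (off e + elen e);
  pos_gen : forall x, vgen x = pgenus (pos x)
}.

Definition realize (H : mgraph R) (M : segment_map H) (p : mpoint H) : mpoint G :=
  match p with
  | Vert x => pos M x
  | @Inner _ _ e t => on_edge (seg M e) (off M e + val t)
  end.

(* [S] is a connected subgraph of some subdivision of [G], of arithmetic genus
   [g]; [H] is that subgraph. *)
Definition subcurve_of_genus (g : nat) (S : set (mpoint G)) : Prop :=
  exists (H : mgraph R) (M : segment_map H),
    [/\ mconnected H, genus H = g, injective (realize M) &
        range (realize M) = S]%classic.

Definition minimal_genus2_containing (C S : set (mpoint G)) : Prop :=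
  let candidate S' := subcurve_of_genus 2%N S' /\ (C `<=` S')%classic in
  candidate S /\ forall S', candidate S' -> (S' `<=` S)%classic -> S' = S.

End Subcurve.

(* The dual graphs of a weighted hyperelliptic admissible cover psi : C -> T of
   genus 2.  The i-th ramification point lies on the component [ram i], over the
   i-th branch point on [bra i]; [vdeg] is the degree of psi on a component,
   [emul] the ramification order at a node.  The edges of [src] are oriented
   compatibly with those of [trg], which is no restriction since no edge is
   contracted and the target is a tree. *)
Record weighted_cover (R : realType) := WeightedCover {
  src : mgraph R;
  trg : mgraph R;
  cV : vert src -> vert trg;
  cE : edge src -> edge trg;
  vdeg : vert src -> nat;
  emul : edge src -> nat;
  ram : 'I_6 -> vert src;
  bra : 'I_6 -> vert trg;
  weight : vert src -> nat;

  src_connected : mconnected src;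
  src_genus : genus src = 2%N;
  trg_connected : mconnected trg;
  trg_genus : genus trg = 0%N;

  cE_src : forall e, esrc (cE e) = cV (esrc e);
  cE_tgt : forall e, etgt (cE e) = cV (etgt e);
  emul_bounds : forall e, (1 <= emul e <= 2)%N;
  vdeg_gt0 : forall v, (0 < vdeg v)%N;
  cE_len : forall e, elen (cE e) = (emul e)%:R * elen e;
  (* psi is finite of degree two, of degree [vdeg v] on the component [v] *)
  cover_degree : forall v' : vert trg, (\sum_(v | cV v == v') vdeg v = 2)%N;
  harmonic : forall (v : vert src) (h' : halfedge trg), base h' = cV v ->
    (\sum_(h : halfedge src | (base h == v) && ((cE h.1, h.2) == h'))
       emul h.1 = vdeg v)%N;
  (* simple ramification at the marked points, and no other ramification at
     smooth points (Riemann-Hurwitz for each component) *)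
  cV_ram : forall i, cV (ram i) = bra i;
  vdeg_ram : forall i, vdeg (ram i) = 2%N;
  riemann_hurwitz : forall v : vert src,
    (2 * vgen v + 2 * vdeg v =
     2 + \sum_(h : halfedge src | base h == v) (emul h.1).-1
       + #|[pred i | ram i == v]|)%N;

  weight_neq0 : exists v, weight v != 0%N;
  stable : forall v' : vert trg,
    (\sum_(v | cV v == v') weight v = 0)%N ->
    (3 <= valence v' + #|[pred i | bra i == v']|)%N
}.

Section Cover.
Variables (R : realType) (X : weighted_cover R).

Definition trop (q : mpoint (src X)) : mpoint (trg X) :=
  match q with
  | Vert v => Vert (cV v)
  | @Inner _ _ e t => on_edge (cE e) ((emul e)%:R * val t)
  end.

Definition branch_deg (p : mpoint (trg X)) : nat :=
  if p is Vert v then #|[pred i | bra X i == v]| else 0%N.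

(* All edges above a given edge have the same expansion factor. *)
Definition expansion2 (e' : edge (trg X)) : bool :=
  [exists e : edge (src X), (cE e == e') && (emul e == 2)%N].

(* The number of directions at [p] that leave [S] and have expansion factor 2:
   the cover restricted to [S] is still ramified at the corresponding nodes,
   which are thus branch points of the restriction. *)
Definition cut_branch_deg (S : set (mpoint (trg X))) (p : mpoint (trg X)) : nat :=
  #|[pred h : halfedge (trg X) |
      [&& tangent p h, ~~ `[< germ_in S p h >] & expansion2 h.1]]|.

(* D'(p) = val(p) - 2 + deg(branch divisor at p) / 2 on the subcurve [S] of the
   target.  For S = setT nothing is cut, and this is val(v) - 2 + deg(D_B|_v)/2
   at a vertex v and 0 inside edges.  The cut directions make the pullback of D'
   equal to the canonical divisor of the preimage of [S]. *)
Definition Dprime (S : set (mpoint (trg X))) (p : mpoint (trg X)) : R :=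
  (valence_in S p)%:R - 2 + (branch_deg p + cut_branch_deg S p)%:R / 2.

Definition admissible (v0 : vert (trg X)) (f : mpoint (trg X) -> R) : Prop :=
  half_PL f /\
  forall p, Dprime setT p + pdiv f p = (`[< p = Vert v0 >])%:R.

Definition normalized (f : mpoint (trg X) -> R) : Prop :=
  (forall v : vert (src X), 0 < f (trop (Vert v)) -> weight v = 0%N) /\
  (1 <= \sum_(v : vert (src X) | (0 <= f (trop (Vert v)))%R) weight v)%N.

Definition lambdaT (L : vert (trg X) -> mpoint (trg X) -> R)
    (p : mpoint (trg X)) : R :=
  \big[Num.max/0]_(v0 : vert (trg X)) L v0 p.

Definition lambda (L : vert (trg X) -> mpoint (trg X) -> R)
    (q : mpoint (src X)) : R := lambdaT L (trop q).

Definition is_Delta (L : vert (trg X) -> mpoint (trg X) -> R)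
    (Delta : set (mpoint (src X))) : Prop :=
  minimal_genus2_containing
    (mclosure [set q | 0 < lambda L q]%classic) Delta.

Definition divD (L : vert (trg X) -> mpoint (trg X) -> R)
    (Delta : set (mpoint (src X))) (p : mpoint (trg X)) : R :=
  Dprime (trop @` Delta)%classic p + pdiv (lambdaT L) p.

End Cover.

(* Main.v *)
Require Import Defs.
From HB Require Import structures.
From mathcomp Require Import all_boot all_order all_algebra.
From mathcomp Require Import all_classical all_reals.
From mathcomp Require Import ring lra zify.

(** Where [lambdaT] is positive, the divisor [D] has integral coefficients, so
    a coefficient [1/2] can only occur where [lambdaT] vanishes.  Indeed
    [Delta_T] contains a neighbourhood of such a point [p], so that [D'] on
    [Delta_T] agrees with [D'] on the whole tree at [p], and in each direction
    [lambdaT] has the slope of one of the admissible functions.  Admissible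
    functions are affine on edges, with half-integral slopes; the difference
    of two of them has an integral divisor, so its doubled slopes form a flow
    modulo 2 on a tree, which vanishes.  The slopes of all admissible
    functions thus agree modulo 1, and [D(p)] is congruent to the coefficient
    at [p] of [D' + div(L v0)], which is 0 or 1. *)

Set Implicit Arguments.
Unset Strict Implicit.

Import Order.TTheory GRing.Theory Num.Theory.

Local Open Scope ring_scope.

(** * Flows on a metric tree with values in a field *)

Section TreeFlow.
Variables (R : realType) (G : mgraph R) (F : fieldType).

(** Converts a slope along the orientation of an edge into the outgoing slope at one of its ends. *)
Definition hsign {K : pzRingType} (h : halfedge G) : K :=
  if h.2 then 1 else -1.

Definition incidence : 'M[F]_(#|edge G|, #|vert G|) :=
  \matrix_(i, j) ((esrc (enum_val i) == enum_val j)%:R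
                - (etgt (enum_val i) == enum_val j)%:R).

Lemma sum_halfedge {V : nmodType} (P : pred (halfedge G)) (f : halfedge G -> V) :
  \sum_(h | P h) f h =
  \sum_e ((if P (e, true) then f (e, true) else 0)
        + (if P (e, false) then f (e, false) else 0)).
Proof.
rewrite big_mkcond /=.
under [RHS]eq_bigr => e _.
  rewrite -(big_bool _ (fun b => if P (e, b) then f (e, b) else 0)).
  over.
by rewrite pair_bigA; apply: eq_bigr => -[].
Qed.

(** With a single component, the truncated difference in [betti1] vanishes only if
    [#|edge G| + 1 <= #|vert G|]. *)
Lemma edges_lt_verts : mconnected G -> genus G = 0%N -> (#|edge G| < #|vert G|)%N.
Proof.
move=> [Vgt0 conn] /eqP; rewrite /genus addn_eq0 => /andP[/eqP b0 _].
have /card_gt0P[v0 _] := Vgt0.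
have sym : connect_sym (@adj R G) by move=> x y; rewrite !conn.
have comp1 : n_comp (@adj R G) (vert G) = 1%N.
  rewrite -(n_comp_connect sym v0); apply: eq_n_comp_r => x.
  by rewrite !inE; apply/esym; exact: conn.
by move: b0; rewrite /betti1 comp1 addn1 => /eqP; rewrite subn_eq0.
Qed.

Lemma incidence_row (e : edge G) :
  row (enum_rank e) incidence =
  delta_mx 0 (enum_rank (esrc e)) - delta_mx 0 (enum_rank (etgt e)).
Proof.
apply/rowP => j; rewrite !mxE enum_rankK eqxx /=.
by congr (_%:R - _%:R); rewrite -(inj_eq enum_val_inj) enum_rankK eq_sym.
Qed.

(* Together with one basis vector, the rows of the incidence matrix of a
   connected graph span everything. *)
Lemma incidence_rank : mconnected G -> (#|vert G| <= (\rank incidence).+1)%N.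
Proof.
move=> [/card_gt0P[v0 _] conn].
pose d v : 'rV[F]_#|vert G| := delta_mx 0 (enum_rank v).
have adjS u v : adj u v -> (d u <= incidence + d v0 -> d v <= incidence + d v0)%MS.
  move=> /existsP[[e b] /andP[/eqP hu /eqP hv]] hdu.
  have re : (row (enum_rank e) incidence <= incidence + d v0)%MS.
    exact: submx_trans (row_sub _ _) (addsmxSl _ _).
  rewrite incidence_row in re.
  case: b hu hv => /=; rewrite /base /= => hu hv; subst u v.
    rewrite (_ : d _ = d (esrc e) - (d (esrc e) - d (etgt e))); last by rewrite subKr.
    by apply: addmx_sub; rewrite ?eqmx_opp.
  rewrite (_ : d _ = (d (esrc e) - d (etgt e)) + d (etgt e)); last by rewrite subrK.
  exact: addmx_sub.
have dsub v : (d v <= incidence + d v0)%MS.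
  have /connectP[p] := conn v0 v.
  have : (d v0 <= incidence + d v0)%MS by exact: addsmxSr.
  (* Only the start of the path is generalised; the [v0] of the spanning space stays fixed. *)
  elim: p {1 3 4}v0 => [|w p IH] u hu /=; first by move=> _ ->.
  by move=> /andP[uw pw] vl; apply: IH pw vl; exact: adjS hu.
have full : (1%:M <= incidence + d v0)%MS.
  by apply/row_subP => i; rewrite row1 -(enum_valK i); exact: dsub.
have := mxrankS full; rewrite mxrank1 => /leq_trans; apply.
apply: leq_trans (mxrank_adds_leqif _ _) _.
by rewrite addnC -[leqRHS]add1n leq_add2r rank_leq_row.
Qed.

(** Conservation at the vertices says that the incidence matrix kills the row vector of [x]. Its
    rows are independent: on a tree there are fewer of them than vertices, and the rank is at least
    the number of vertices minus one. *)
Lemma tree_flow_eq0 (x : edge G -> F) :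
  mconnected G -> genus G = 0%N ->
  (forall v, \sum_(h : halfedge G | base h == v) hsign h * x h.1 = 0) ->
  forall e, x e = 0.
Proof.
move=> conn g0 flow e.
have free : row_free incidence.
  rewrite /row_free eqn_leq rank_leq_row /= -ltnS.
  exact: leq_trans (edges_lt_verts conn g0) (incidence_rank conn).
pose u : 'rV[F]_#|edge G| := \row_i x (enum_val i).
have : u *m incidence = 0.
  apply/rowP => j; rewrite !mxE -[RHS](flow (enum_val j)) sum_halfedge.
  rewrite [RHS](reindex (@enum_val _ (edge G))) /=; last first.
    by apply: onW_bij; exact: enum_val_bij.
  apply: eq_bigr => i _; rewrite !mxE /base /hsign /=.
  by case: eqP => _; case: eqP => _ /=; ring.
rewrite -[RHS](mul0mx _ incidence) => /(row_free_inj free).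
by move/rowP/(_ (enum_rank e)); rewrite !mxE enum_rankK.
Qed.

End TreeFlow.

(** * Germs to the right of 0 and maxima of affine germs *)

Section RightGerms.
Variable R : realType.

(** The point 0 is included, so a germ also determines the value at the base point. *)
Definition near_right (P : R -> Prop) : Prop :=
  exists2 eps : R, 0 < eps & forall t, 0 <= t <= eps -> P t.

Lemma near_right_and (P Q : R -> Prop) :
  near_right P -> near_right Q -> near_right (fun t => P t /\ Q t).
Proof.
move=> [a a0 Pa] [b b0 Qb]; exists (Num.min a b); first by rewrite lt_min a0.
by move=> t; rewrite le_min => /and3P[t0 ta tb]; split; [apply: Pa|apply: Qb]; rewrite t0.
Qed.

Lemma near_right_impl (P Q : R -> Prop) :
  (forall t, P t -> Q t) -> near_right P -> near_right Q.
Proof. by move=> PQ [a a0 Pa]; exists a => // t /Pa /PQ. Qed.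

Lemma near_right_pos (a s : R) : 0 < a -> near_right (fun t => 0 < a + s * t).
Proof.
move=> a0; pose c := `|s| + 1; have c0 : 0 < c by rewrite ltr_pwDr.
(* Since [c] exceeds the absolute value of [s], the linear term stays above [- a / 2] on this
   interval. *)
exists (a / c / 2); first by rewrite !divr_gt0.
move=> t /andP[t0 tc].
have : c * t <= a / 2.
  by rewrite mulrC -ler_pdivlMr // mulrAC.
have : - (c * t) <= s * t.
  rewrite -mulNr ler_wpM2r //.
  by have := ler_norm (- s); rewrite normrN /c; lra.
lra.
Qed.

(** The values at 0 decide, and in case of a tie the slopes do. *)
Lemma affine_germ_total (a1 s1 a2 s2 : R) :
  near_right (fun t => a1 + s1 * t <= a2 + s2 * t) \/
  near_right (fun t => a2 + s2 * t <= a1 + s1 * t).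
Proof.
have strict x1 r1 x2 r2 : x1 < x2 -> near_right (fun t => x1 + r1 * t <= x2 + r2 * t).
  rewrite -subr_gt0 => /(near_right_pos (r2 - r1)).
  by apply: near_right_impl => t; lra.
have [lt|lt|->] := ltgtP a1 a2; [by left; exact: strict|by right; exact: strict|].
have [les|/ltW les] := leP s1 s2; [left|right];
  by exists 1 => // t /andP[t0 _]; rewrite lerD2l ler_wpM2r.
Qed.

(** Affine germs are totally ordered, so each binary maximum is one of its arguments. The first
    alternative accounts for the initial value 0 of the iterated maximum. *)
Lemma bigmax_affine_germ (I : Type) (r : seq I) (f : I -> R -> R) (a s : I -> R) :
  (forall i, near_right (fun t => f i t = a i + s i * t)) ->
  near_right (fun t => \big[Num.max/0]_(i <- r) f i t = 0) \/
  exists i, near_right (fun t => \big[Num.max/0]_(i <- r) f i t = f i t).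
Proof.
move=> faff.
have step i (g : R -> R) b c : near_right (fun t => g t = b + c * t) ->
    near_right (fun t => Num.max (f i t) (g t) = f i t) \/
    near_right (fun t => Num.max (f i t) (g t) = g t).
  move=> gaff; have [|] := affine_germ_total (a i) (s i) b c;
    move=> /(near_right_and (near_right_and (faff i) gaff)) H; [right|left];
    apply: near_right_impl H => t [[-> ->] le].
  - exact: max_r.
  - exact: max_l.
elim: r => [|i r [IH|[j IH]]].
- by left; exists 1 => // t _; rewrite big_nil.
- have [|H|H] := step i (fun t => \big[Num.max/0]_(i <- r) f i t) 0 0.
  + by apply: near_right_impl IH => t ->; rewrite mul0r addr0.
  + by right; exists i; apply: near_right_impl H => t; rewrite big_cons.
  + left; apply: near_right_impl (near_right_and IH H) => t [h0].
    by rewrite big_cons => ->.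
- have [|H|H] := step i (fun t => \big[Num.max/0]_(i <- r) f i t) (a j) (s j).
  + by apply: near_right_impl (near_right_and IH (faff j)) => t [-> ->].
  + by right; exists i; apply: near_right_impl H => t; rewrite big_cons.
  + right; exists j; apply: near_right_impl (near_right_and IH H) => t [h0].
    by rewrite big_cons => ->.
Qed.

End RightGerms.

(** * Directions, slopes and functions affine on edges *)

Section EdgeParametrisation.
Variables (R : realType) (G : mgraph R).
Implicit Types (e : edge G) (p : mpoint G) (h : halfedge G) (f : mpoint G -> R).

Lemma on_edge0 e : on_edge e 0 = Vert (esrc e).
Proof. by rewrite /on_edge insubF ?ltxx //= lexx. Qed.

Lemma on_edge_len e : on_edge e (elen e) = Vert (etgt e).
Proof. by rewrite /on_edge insubF ?ltxx ?andbF //= leNgt elen_gt0. Qed.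

Lemma on_edge_inner e (s : {t : R | 0 < t < elen e}) : on_edge e (val s) = Inner s.
Proof. by rewrite /on_edge valK. Qed.

Lemma on_edge_interior e x : 0 < x < elen e ->
  exists2 s : {t : R | 0 < t < elen e}, on_edge e x = Inner s & val s = x.
Proof. by move=> xe; exists (exist _ x xe) => //; rewrite -on_edge_inner. Qed.

(** Treats vertices and inner points alike: every direction is motion along a closed edge from a
    coordinate [x], which is 0 or [elen h.1] at a vertex. *)
Lemma travelP p h : tangent p h ->
  exists x, [/\ 0 <= x <= elen h.1, p = on_edge h.1 x &
    near_right (fun t => travel p h t = on_edge h.1 (x + hsign h * t) /\
                         0 <= x + hsign h * t <= elen h.1)].
Proof.
case: p => [v|e s]; case: h => e' b /=.
  rewrite /base /hsign /= => /eqP <-; have e0 := elen_gt0 e'.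
  case: b => /=; [exists 0|exists (elen e')]; split=> //;
    rewrite ?on_edge0 ?on_edge_len ?lexx ?ltW //;
    exists (elen e') => // t /andP[t0 te]; split; by [congr on_edge; lra|lra].
move=> /eqP ->; exists (val s); have /andP[s0 se] := valP s.
split; [by rewrite !ltW|by rewrite on_edge_inner|].
exists (Num.min (val s) (elen e - val s)); first by rewrite lt_min s0 subr_gt0.
move=> t; rewrite le_min => /and3P[t0 ts te]; rewrite /hsign /=.
by case: b; (split; [congr on_edge|move: s0 se ts te => /=]; lra).
Qed.

Lemma travel0 p h : tangent p h -> travel p h 0 = p.
Proof.
move=> /travelP[x [_ pE [eps e0 /(_ 0)]]].
by rewrite lexx ltW // mulr0 addr0 -pE => /(_ isT)[].
Qed.

Lemma germ_in_setT p h : germ_in setT p h.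
Proof. by exists 1. Qed.

Lemma has_slope_uniq f p h s s' : has_slope f p h s -> has_slope f p h s' -> s = s'.
Proof.
move=> H H'; have [eps e0 E] := near_right_and H H'.
have [|-> /addrI] := E eps; first by rewrite lexx ltW.
by move/mulIf; apply; rewrite gt_eqF.
Qed.

Lemma has_slopeE f p h s : has_slope f p h s -> slope f p h = s.
Proof.
move=> H; rewrite /slope; case: xgetP => [y _ Hy|/(_ s)]; last by case.
exact: has_slope_uniq Hy H.
Qed.

Lemma eq_germ_slope f g p h s : has_slope g p h s ->
  near_right (fun t => f (travel p h t) = g (travel p h t)) -> f p = g p ->
  slope f p h = slope g p h.
Proof.
move=> gs fg fgp; rewrite (has_slopeE gs); apply: has_slopeE.
rewrite /has_slope fgp.
by apply: near_right_impl (near_right_and gs fg) => t [<- ->].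
Qed.

Lemma sum_tangent_inner e (s : {t : R | 0 < t < elen e}) (V : nmodType)
    (f : halfedge G -> V) :
  \sum_(h | tangent (Inner s) h) f h = f (e, true) + f (e, false).
Proof.
rewrite sum_halfedge (bigD1 e) //= eqxx big1 ?addr0 // => e' /negPf ->.
by rewrite addr0.
Qed.

(** Here [k] is the doubled slope along the orientation, an integer that can be reduced modulo 2. *)
Definition affine_slope f (k : edge G -> int) : Prop := forall e x,
  0 <= x <= elen e -> f (on_edge e x) = f (on_edge e 0) + (k e)%:~R / 2 * x.

Lemma affine_has_slope f k p h : affine_slope f k -> tangent p h ->
  has_slope f p h (hsign h * ((k h.1)%:~R / 2)).
Proof.
move=> fk /travelP[x [xe pE H]].
apply: near_right_impl H => t [-> te].
by rewrite pE (fk _ _ te) (fk _ _ xe); ring.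
Qed.

Lemma affine_pdiv f k p : affine_slope f k ->
  Defs.pdiv f p = \sum_(h | tangent p h) hsign h * ((k h.1)%:~R / 2).
Proof.
by move=> fk; apply: eq_bigr => h ph; apply: has_slopeE; exact: affine_has_slope.
Qed.

(** Inside an edge the divisor measures the change of slope, so its vanishing removes every
    breakpoint. *)
Lemma half_PL_affine f : half_PL f ->
  (forall e (s : {t : R | 0 < t < elen e}), Defs.pdiv f (Inner s) = 0) ->
  exists k, affine_slope f k.
Proof.
move=> fPL fdiv; suff /choice [k kP] : forall e, exists k : int, forall x,
    0 <= x <= elen e -> f (on_edge e x) = f (on_edge e 0) + k%:~R / 2 * x.
  by exists k.
move=> e; have [n [t [t0 tn tlt tk]]] := fPL e.
have tmono i j : (i < j)%N -> (j <= n)%N -> t i < t j.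
  elim: j => // j IH; rewrite ltnS leq_eqVlt => /orP[/eqP ->|ij] jn; first exact: tlt.
  by apply: lt_trans (tlt _ jn); apply: IH (ltnW jn).
have n0 : (0 < n)%N.
  by case: n tn {tlt tk tmono} => // tn; have := elen_gt0 e; rewrite -tn t0 ltxx.
(* The affine piece starting at 0 is extended past one breakpoint at a time. *)
suff H m : (m < n)%N -> exists k : int, forall x,
    0 <= x <= t m.+1 -> f (on_edge e x) = f (on_edge e 0) + k%:~R / 2 * x.
  by have := H n.-1; rewrite prednK // tn; apply.
elim: m => [|m IH] mn.
  have [k kP] := tk _ mn; exists k => x xt.
  by have := kP x; rewrite t0 subr0; apply.
have [k kP] := IH (ltnW mn); have [k' kP'] := tk _ mn.
have c0 : 0 < t m.+1 by rewrite -t0; exact: tmono (ltnW mn).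
have ce : t m.+1 < elen e by rewrite -tn; exact: tmono.
have cd := tlt _ mn.
have [|s sE sv] := @on_edge_interior e (t m.+1); first by rewrite c0.
have right_slope : has_slope f (Inner s) (e, true) (k'%:~R / 2).
  exists (t m.+2 - t m.+1); first by rewrite subr_gt0.
  move=> x /andP[x0 xe]; rewrite /= sv kP' ?sE; last by lra.
  by congr (_ + _ * _); ring.
have left_slope : has_slope f (Inner s) (e, false) (- (k%:~R / 2)).
  exists (t m.+1) => // x /andP[x0 xe]; rewrite /= sv -sE.
  by rewrite (kP (t m.+1 - x)) ?(kP (t m.+1)); [ring|lra|lra].
have kk' : k%:~R / 2 = k'%:~R / 2 :> R.
  have := fdiv e s; rewrite /Defs.pdiv sum_tangent_inner.
  by rewrite (has_slopeE right_slope) (has_slopeE left_slope); lra.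
exists k => x /andP[x0 xd]; have [xc|cx] := leP x (t m.+1).
  by apply: kP; rewrite x0.
rewrite kP'; last by rewrite xd ltW.
by rewrite (kP (t m.+1)) ?lexx ?ltW // -kk'; ring.
Qed.

End EdgeParametrisation.

(** * Admissible functions on the target tree, and surjectivity of [trop] *)

Section Cover.
Variables (R : realType) (X : weighted_cover R).
Implicit Types (p : mpoint (trg X)) (f : mpoint (trg X) -> R).

Lemma Dprime_eq_setT (S : set (mpoint (trg X))) p :
  (forall h, tangent p h -> germ_in S p h) -> Dprime S p = Dprime setT p.
Proof.
move=> Sp; rewrite /Dprime; congr (_%:R - _ + (_ + _)%:R / _); apply: eq_card => h;
  rewrite !inE; case: (boolP (tangent p h)) => //= /Sp Sh;
  by rewrite (asboolT Sh) (asboolT (germ_in_setT _ _)).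
Qed.

Lemma Dprime_setT_inner (e : edge (trg X)) (s : {t : R | 0 < t < elen e}) :
  Dprime setT (Inner s) = 0.
Proof.
have germT h : `[< germ_in setT (Inner s) h >] by exact/asboolP/germ_in_setT.
have -> : Dprime setT (Inner s) = 2%:R - 2 + (0 + 0)%:R / 2.
  rewrite /Dprime /=; congr (_%:R - _ + (_ + _)%:R / _).
    have -> : 2%N = #|[set (e, true); (e, false)]| by rewrite cards2 xpair_eqE andbF.
    apply: eq_card => -[e' b]; rewrite !inE germT andbT /= !xpair_eqE.
    by case: b; rewrite ?andbT ?andbF ?orbF.
  by apply: eq_card0 => h; rewrite !inE germT andbF.
by rewrite subrr mul0r addr0.
Qed.

(** Inside edges both [Dprime setT] and the divisor of [v0] vanish, hence so does that of [f]. *)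
Lemma admissible_affine v0 f : admissible v0 f -> exists k, affine_slope f k.
Proof.
move=> [fPL fdiv]; apply: half_PL_affine => // e s.
have := fdiv (Inner s); rewrite Dprime_setT_inner add0r => ->.
by rewrite asboolF.
Qed.

Lemma intr_F2_eq0 (m : int) : m%:~R = 0 :> 'F_2 -> exists n : int, m = n * 2.
Proof.
move=> /eqP; rewrite -(dvdz_pcharf (pchar_Fp (isT : prime 2))) => /dvdzP[n ->].
by exists n.
Qed.

Lemma admissible_slope_mod1 (v0 v1 : vert (trg X)) f g k l :
  admissible v0 f -> admissible v1 g -> affine_slope f k -> affine_slope g l ->
  forall e, exists n : int, (k e)%:~R / 2 - (l e)%:~R / 2 = n%:~R :> R.
Proof.
move=> [_ fdiv] [_ gdiv] fk gl e.
suff /intr_F2_eq0[n kl] : (k e - l e)%:~R = 0 :> 'F_2.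
  exists n; rewrite -mulrBl -intrB kl intrM.
  by rewrite mulfK // pnatr_eq0.
apply: (@tree_flow_eq0 _ (trg X) _ (fun e => (k e - l e)%:~R)).
- exact: trg_connected.
- exact: trg_genus.
move=> v; set P := fun h => base h == v.
(* Subtracting the two admissibility equations cancels [Dprime]; the factor 2 comes from doubling
   the slopes and dies in ['F_2]. *)
have flow : \sum_(h | P h) hsign h * (k h.1 - l h.1) =
    2 * (`[< Vert v = Vert v0 :> mpoint (trg X) >]%:R
       - `[< Vert v = Vert v1 :> mpoint (trg X) >]%:R) :> int.
  apply: (@intr_inj R); rewrite raddf_sum intrM intrB !rmorph_nat /=.
  rewrite -(fdiv (Vert v)) -(gdiv (Vert v)) (affine_pdiv _ fk) (affine_pdiv _ gl).
  rewrite opprD addrACA subrr add0r -sumrB mulr_sumr.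
  apply: eq_bigr => h _; rewrite intrM intrB.
  by rewrite /hsign; case: h.2; rewrite ?rmorphN rmorph1; field.
transitivity ((\sum_(h | P h) hsign h * (k h.1 - l h.1))%:~R : 'F_2).
  rewrite raddf_sum; apply: eq_bigr => h _ /=; rewrite intrM; congr (_ * _).
  by rewrite /hsign; case: h.2; rewrite ?rmorphN rmorph1.
rewrite flow intrM (_ : 2%:~R = 0 :> 'F_2) ?mul0r //.
exact/val_inj.
Qed.

(** A vertex has a preimage because its fibre has total degree 2, an edge because harmonicity
    equates a sum over its preimages with a positive local degree. *)
Lemma trop_surj p : exists q, trop q = p.
Proof.
have vsurj v' : exists v, cV v = v' :> vert (trg X).
  apply: contrapT => no; have := cover_degree v'; rewrite big_pred0 // => v.
  by apply/negbTE/eqP => E; apply: no; exists v.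
case: p => [v'|e' s]; first by have [v <-] := vsurj v'; exists (Vert v).
have [v hv] := vsurj (esrc e').
have [e ee'] : exists e, cE e = e' :> edge (trg X).
  apply: contrapT => no; have := vdeg_gt0 v.
  rewrite -(@harmonic _ X v (e', true)) ?hv // big_pred0 // => h.
  apply/negbTE/negP => /andP[_]; rewrite xpair_eqE => /andP[/eqP E _].
  by apply: no; exists h.1.
subst e'; have /andP[s0 se] := valP s.
have m0 : 0 < (emul e)%:R :> R by rewrite ltr0n; case/andP: (emul_bounds e).
(* [trop] stretches [e] by the factor [emul e], so the preimage lies at the coordinate divided by
   it. *)
have lt : 0 < val s / (emul e)%:R < elen e.
  by rewrite divr_gt0 //= ltr_pdivrMr // mulrC -cE_len.
exists (Inner (exist (fun t : R => 0 < t < elen e) _ lt)); rewrite /= mulrC divfK ?gt_eqF //.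
exact: on_edge_inner.
Qed.

(** * Integrality of [divD] where [lambdaT] is positive *)

Section Lambda.
Variable L : vert (trg X) -> mpoint (trg X) -> R.
Hypothesis Ladm : forall v0, admissible v0 (L v0).

Lemma lambdaT_ge0 p : 0 <= lambdaT L p.
Proof.
by rewrite /lambdaT; elim/big_rec: _ => // v x _ x0; rewrite le_max x0 orbT.
Qed.

Lemma lambdaT_germ p h : tangent p h -> 0 < lambdaT L p ->
  exists v, near_right (fun t => lambdaT L (travel p h t) = L v (travel p h t)).
Proof.
move=> ph lp.
have [k kP] := choice (fun v => admissible_affine (Ladm v)).
have germ v := affine_has_slope (kP v) ph.
(* A maximum that is the zero germ would vanish at [p] itself, against positivity. *)
have [[eps e0 /(_ 0)]|//] := bigmax_affine_germ (index_enum _) germ.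
by rewrite lexx ltW // travel0 // => /(_ isT) E; move: lp; rewrite /lambdaT E ltxx.
Qed.

(** Positivity persists for a short time in the direction [h], and the points reached lift to the
    positive locus of [lambda], which [Delta] contains. *)
Lemma lambdaT_germ_in (Delta : set (mpoint (src X))) p h :
  is_Delta L Delta -> tangent p h -> 0 < lambdaT L p ->
  germ_in (trop (X:=X) @` Delta)%classic p h.
Proof.
move=> [[_ sub] _] ph lp; have [v vE] := lambdaT_germ ph lp.
have [k fk] := admissible_affine (Ladm v).
have vp : 0 < L v p.
  have [eps e0 /(_ 0)] := vE.
  by rewrite lexx ltW // travel0 // => /(_ isT) <-.
have pos := near_right_pos (hsign h * ((k h.1)%:~R / 2)) vp.
apply: near_right_impl (near_right_and (near_right_and vE (affine_has_slope fk ph)) pos).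
move=> t [[E1 E2] E3]; have [q qE] := trop_surj (travel p h t).
by exists q => //; apply: sub; left; rewrite /= /lambda qE E1 E2.
Qed.

Lemma divD_int (Delta : set (mpoint (src X))) p :
  is_Delta L Delta -> 0 < lambdaT L p -> exists n : int, divD L Delta p = n%:~R.
Proof.
move=> HD lp.
have [/card_gt0P[v0 _] _] := trg_connected X.
have [k kP] := choice (fun v => admissible_affine (Ladm v)).
have slope_mod1 h : exists n : int, tangent p h ->
    slope (lambdaT L) p h = slope (L v0) p h + n%:~R.
  have [ph|_] := boolP (tangent p h); last by exists 0.
  have [v vE] := lambdaT_germ ph lp.
  have [n nE] := admissible_slope_mod1 (Ladm v) (Ladm v0) (kP v) (kP v0) h.1.
  exists (hsign h * n) => _.
  have eqp : lambdaT L p = L v p.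
    by have [eps e0 /(_ 0)] := vE; rewrite lexx ltW // travel0 // => /(_ isT).
  rewrite (eq_germ_slope (affine_has_slope (kP v) ph) vE eqp).
  rewrite !(has_slopeE (affine_has_slope (kP _) ph)) intrM -nE.
  by rewrite /hsign; case: h.2; rewrite ?rmorphN rmorph1; ring.
have [n nE] := choice slope_mod1.
(* The coefficient at [p] of [Dprime setT] plus the divisor of [L v0], corrected by the integral
   slope differences. *)
exists ((`[< p = Vert v0 >])%:R + \sum_(h | tangent p h) n h).
rewrite intrD rmorph_nat -(Ladm v0).2 raddf_sum -addrA -big_split /divD /=.
rewrite Dprime_eq_setT; last by move=> h ph; exact: lambdaT_germ_in.
by congr (_ + _); apply: eq_bigr => h ph; rewrite nE.
Qed.

Lemma divD_half_lambdaT0 (Delta : set (mpoint (src X))) p :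
  is_Delta L Delta -> divD L Delta p = 1 / 2 -> lambdaT L p = 0.
Proof.
move=> HD half; apply/eqP; rewrite eq_le lambdaT_ge0 andbT leNgt.
apply/negP => /(divD_int HD)[n]; rewrite half => nE.
(* An integral coefficient equal to one half would make 1 even. *)
have : (n * 2)%:~R = 1%:~R :> R by rewrite intrM -nE; field.
by move/intr_inj; case: n {nE} => n; lia.
Qed.

End Lambda.
End Cover.

Theorem lemma3p18 (R : realType) (X : weighted_cover R)
    (L : vert (trg X) -> mpoint (trg X) -> R)
    (Ladm : forall v0 : vert (trg X), admissible v0 (L v0))
    (Lnorm : forall v0 : vert (trg X), normalized (L v0))
    (Delta : set (mpoint (src X))) (HDelta : is_Delta L Delta)
    (D1 D2 : mpoint (trg X))
    (D1in : (trop (X:=X) @` Delta)%classic D1)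
    (D2in : (trop (X:=X) @` Delta)%classic D2)
    (D12 : D1 <> D2)
    (HD : forall p : mpoint (trg X), (trop (X:=X) @` Delta)%classic p ->
       divD L Delta p = ((`[< p = D1 >])%:R + (`[< p = D2 >])%:R) / 2) :
  lambdaT L D1 = 0 /\ lambdaT L D2 = 0.
Proof.
have [D1D2 D2D1] : D1 <> D2 /\ D2 <> D1 by split=> // /esym.
(* As the two points differ, each has coefficient exactly one half. *)
split; apply: (divD_half_lambdaT0 Ladm HDelta); rewrite HD //.
- by rewrite asboolT // asboolF // addr0.
- by rewrite asboolF // asboolT // add0r.
Qed.
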